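(* Let $\nabla$ be the Levi-Civita connection on $T\mathbb{RP}^3$ of the standard metric $g_{\mathrm{St}}$ on $\mathbb{RP}^3$, and let $\nu$ be the $\nabla$-parallel volume form on $\mathbb{RP}^3$ that corresponds to $\omega_1\wedge\omega_2\wedge\psi$ under the isometry of $(\mathbb{RP}^3,g_{\mathrm{St}})$ with $\mathrm{SO}(3)$ equipped with the metric $\tfrac14\left((\omega_1)^2+(\omega_2)^2+\psi^2\right)$. Then there exists no global equiaffine immersion of $(\mathbb{RP}^3,\nabla,\nu)$ into $\mathbb R^4$.
   Context: The left-invariant $1$-forms $\omega_1,\omega_2,\psi$ on $\mathrm{SO}(3)$ are defined by writing the Maurer--Cartan form of $\mathrm{SO}(3)$ as $$\mu_3=\begin{pmatrix}0&-\omega_1&-\omega_2\\ \omega_1&0&-\psi\\ \omega_2&\psi&0\end{pmatrix}.$$ The standard metric $g_{\mathrm{St}}$ on $\mathbb{RP}^3$ is the one induced by the round metric of the unit sphere $S^3$; $(\mathbb{RP}^3,g_{\mathrm{St}})$ is isometric to $\mathrm{SO}(3)$ with the metric $\tfrac14((\omega_1)^2+(\omega_2)^2+\psi^2)$. Equiaffine immersion: for a $3$-manifold $M$ with fixed volume form $\nu$ and torsion-free linear connection $\nabla$ on $TM$ preserving $\nu$, an equiaffine immersion of $(M,\nabla,\nu)$ into $\mathbb R^4$ consists of a smooth immersion $i:M\to\mathbb R^4$ and a smooth choice of transversal $\ell:M\to\mathbb{RP}^3$, i.e. for each $x\in M$ a line $\ell(x)\subset\mathbb R^4$ complementary to $T_xi(T_xM)$,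 such that the induced connection $\nabla^\top$ on $TM$ coincides with $\nabla$. Here $\nabla^\top$ is defined by decomposing the derivative $D_\xi(Ti\circ\eta)$, with $D$ the flat connection on $\mathbb R^4$, along $\mathbb R^4=T_xi(T_xM)\oplus\ell(x)$ and letting $Ti(\nabla^\top_\xi\eta)$ be the component in $T_xi(T_xM)$. *)

(* Defs.v *)
From HB Require Import structures.
From mathcomp Require Import all_boot all_order all_algebra.
From mathcomp Require Import all_classical all_reals all_analysis.

Set Implicit Arguments.
Unset Strict Implicit.
Unset Printing Implicit Defensive.

Import Order.TTheory GRing.Theory Num.Theory.
Import numFieldNormedType.Exports.

Local Open Scope classical_set_scope.
Local Open Scope ring_scope.

Section Smooth.
Context {R : realType} {V W : normedModType R}.

Fixpoint Ck_on (k : nat) (U : set V) (f : V -> W) : Prop :=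
  if k is k'.+1 then
    (forall x, U x -> differentiable f x) /\
    (forall v, Ck_on k' U (fun x => 'D_v f x))
  else forall x, U x -> {for x, continuous f}.

(* C^oo; meaningful for open U *)
Definition smooth_on (U : set V) (f : V -> W) : Prop := forall k, Ck_on k U f.

End Smooth.

(* Real projective space RP^3 is the set of lines of R^4.  It is handled
   through the submersion line : R^4 \ {0} -> RP^3, as follows.
   - F : RP^3 -> W is smooth iff F \o line is smooth on R^4 \ {0}.
   - The tangent space at line x is the orthogonal complement of x, where the
     vector v at x and the vector c v at c x (c != 0) represent the same tangent
     vector.  For x and c x on the unit sphere (so that c = -1 or 1), this is the
     tangent bundle of S^3 modulo the antipodal map.  The differential of F sends
     v to 'D_v (F \o line) x.
   - A vector field is a smooth map X : R^4 \ {0} -> R^4 with X x orthogonal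
     to x and X (c x) = c X x.  *)
Section ProjectiveSpace.
Context {R : realType}.

Lemma dim_default_line :
  \dim <[(delta_mx 0 0)%R : 'rV[R]_4]> == 1%N.
Proof.
have nz : (delta_mx 0 0 : 'rV[R]_4) != 0.
  by apply/eqP => /matrixP/(_ 0 0) /eqP; rewrite !mxE !eqxx oner_eq0.
by rewrite dim_vline nz.
Qed.

Definition RP3 : Type := {L : {vspace 'rV[R]_4} | \dim L == 1%N}.

(* line 0 is a junk value *)
Definition line (x : 'rV[R]_4) : RP3 :=
  insubd (exist (fun L : {vspace 'rV[R]_4} => \dim L == 1%N) _ dim_default_line)
         <[x]>%VS.

Definition punctured : set 'rV[R]_4 := [set x | x != 0].

Definition smooth_on_RP3 (W : normedModType R) (F : RP3 -> W) : Prop :=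
  smooth_on punctured (F \o line).

(* Smoothness on a subset A of V of a map to RP^3: locally it lifts to a map to
   R^4 \ {0} that is smooth on an open set of V. *)
Definition smooth_into_RP3 (V : normedModType R) (A : set V) (f : V -> RP3) : Prop :=
  forall x, A x -> exists (U : set V) (s : V -> 'rV[R]_4),
    [/\ open U, U x, smooth_on U s, (forall y, U y -> s y != 0)
      & forall y, U y -> A y -> f y = line (s y)].

Definition dot (u v : 'rV[R]_4) : R := (u *m v^T) 0 0.

Definition tangent (x : 'rV[R]_4) : {vspace 'rV[R]_4} :=
  lker (linfun (mulmxr x^T : 'rV[R]_4 -> 'M[R]_1)).

(* The round metric of S^3 on unit x, extended so that v at x and c v at c x
   have the same length. *)
Definition g_St (x u v : 'rV[R]_4) : R := dot u v / dot x x.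

(* Homogeneity at c = 0 normalizes the irrelevant value X 0 to be 0. *)
Definition vector_field (X : 'rV[R]_4 -> 'rV[R]_4) : Prop :=
  [/\ smooth_on punctured X,
      forall x, x != 0 -> X x \in tangent x
    & forall (c : R) x, X (c *: x) = c *: X x].

Definition along (W : normedModType R) (X : 'rV[R]_4 -> 'rV[R]_4)
    (f : 'rV[R]_4 -> W) (x : 'rV[R]_4) : W := 'D_(X x) f x.

(* The lift of the Lie bracket: it is again tangent and homogeneous. *)
Definition lie_bracket (X Y : 'rV[R]_4 -> 'rV[R]_4) (x : 'rV[R]_4) : 'rV[R]_4 :=
  along X Y x - along Y X x.

Definition operator := ('rV[R]_4 -> 'rV[R]_4) -> ('rV[R]_4 -> 'rV[R]_4) ->
  'rV[R]_4 -> 'rV[R]_4.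

Record linear_connection (nabla : operator) : Prop := {
  lc_vector_field : forall X Y, vector_field X -> vector_field Y ->
    vector_field (nabla X Y);
  lc_addl : forall X X' Y x,
    vector_field X -> vector_field X' -> vector_field Y -> x != 0 ->
    nabla (fun y => X y + X' y) Y x = nabla X Y x + nabla X' Y x;
  lc_scalel : forall (f : RP3 -> R) X Y x,
    smooth_on_RP3 f -> vector_field X -> vector_field Y -> x != 0 ->
    nabla (fun y => f (line y) *: X y) Y x = f (line x) *: nabla X Y x;
  lc_addr : forall X Y Y' x,
    vector_field X -> vector_field Y -> vector_field Y' -> x != 0 ->
    nabla X (fun y => Y y + Y' y) x = nabla X Y x + nabla X Y' x;
  lc_leibniz : forall (f : RP3 -> R) X Y x,
    smooth_on_RP3 f -> vector_field X -> vector_field Y -> x != 0 ->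
    nabla X (fun y => f (line y) *: Y y) x =
      along X (f \o line) x *: Y x + f (line x) *: nabla X Y x }.

Definition torsion_free (nabla : operator) : Prop :=
  forall X Y x, vector_field X -> vector_field Y -> x != 0 ->
    nabla X Y x - nabla Y X x = lie_bracket X Y x.

Definition metric_compatible (g : 'rV[R]_4 -> 'rV[R]_4 -> 'rV[R]_4 -> R)
    (nabla : operator) : Prop :=
  forall X Y Z x, vector_field X -> vector_field Y -> vector_field Z -> x != 0 ->
    along X (fun y => g y (Y y) (Z y)) x =
      g x (nabla X Y x) (Z x) + g x (Y x) (nabla X Z x).

Definition levi_civita (g : 'rV[R]_4 -> 'rV[R]_4 -> 'rV[R]_4 -> R)
    (nabla : operator) : Prop :=
  [/\ linear_connection nabla, torsion_free nabla & metric_compatible g nabla].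

(* A form has a value nu x u v w for x != 0 and u, v, w tangent at x; the other
   values are irrelevant. *)
Definition form := 'rV[R]_4 -> 'rV[R]_4 -> 'rV[R]_4 -> 'rV[R]_4 -> R.

Record volume_form (nu : form) : Prop := {
  vf_linear : forall x (a : R) u u' v w, x != 0 ->
    u \in tangent x -> u' \in tangent x -> v \in tangent x -> w \in tangent x ->
    nu x (a *: u + u') v w = a * nu x u v w + nu x u' v w;
  vf_alt12 : forall x u v w, x != 0 ->
    u \in tangent x -> v \in tangent x -> w \in tangent x ->
    nu x v u w = - nu x u v w;
  vf_alt23 : forall x u v w, x != 0 ->
    u \in tangent x -> v \in tangent x -> w \in tangent x ->
    nu x u w v = - nu x u v w;
  vf_invariant : forall (c : R) x u v w, c != 0 -> x != 0 ->
    u \in tangent x -> v \in tangent x -> w \in tangent x ->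
    nu (c *: x) (c *: u) (c *: v) (c *: w) = nu x u v w;
  vf_smooth : forall X Y Z,
    vector_field X -> vector_field Y -> vector_field Z ->
    smooth_on punctured (fun x => nu x (X x) (Y x) (Z x));
  vf_nonzero : forall x, x != 0 -> exists u v w,
    [/\ u \in tangent x, v \in tangent x, w \in tangent x & nu x u v w != 0] }.

Definition parallel (nabla : operator) (nu : form) : Prop :=
  forall X Y Z T x,
    vector_field X -> vector_field Y -> vector_field Z -> vector_field T ->
    x != 0 ->
    along X (fun y => nu y (Y y) (Z y) (T y)) x =
      nu x (nabla X Y x) (Z x) (T x) + nu x (Y x) (nabla X Z x) (T x)
      + nu x (Y x) (Z x) (nabla X T x).

End ProjectiveSpace.

Arguments RP3 : clear implicits.
Arguments operator : clear implicits.
Arguments form : clear implicits.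

Section SO3.
Context {R : realType}.

Definition SO3 : set 'M[R]_3 := [set A | A^T *m A = 1%:M /\ \det A = 1].

(* The Maurer-Cartan form A^-1 dA, at A in SO(3), on a tangent matrix B. *)
Definition maurer_cartan (A B : 'M[R]_3) : 'M[R]_3 := invmx A *m B.

Definition omega1 (A B : 'M[R]_3) : R := maurer_cartan A B (inord 1) (inord 0).
Definition omega2 (A B : 'M[R]_3) : R := maurer_cartan A B (inord 2) (inord 0).
Definition psi (A B : 'M[R]_3) : R := maurer_cartan A B (inord 2) (inord 1).

Definition g_SO3 (A B C : 'M[R]_3) : R :=
  4^-1 * (omega1 A B * omega1 A C + omega2 A B * omega2 A C + psi A B * psi A C).

Definition wedge3 (a b c : 'M[R]_3 -> R) (B C D : 'M[R]_3) : R :=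
  \det (\matrix_(i < 3, j < 3)
    nth (fun=> 0) [:: a; b; c] i (nth 0 [:: B; C; D] j)).

Definition isometry_RP3_SO3 (Phi : RP3 R -> 'M[R]_3) : Prop :=
  [/\ smooth_on_RP3 Phi,
      forall L, SO3 (Phi L),
      exists Psi : 'M[R]_3 -> RP3 R,
        [/\ smooth_into_RP3 SO3 Psi, cancel Phi Psi & {in SO3, cancel Psi Phi}]
    & forall x u v, x != 0 -> u \in tangent x -> v \in tangent x ->
        g_SO3 (Phi (line x)) ('D_u (Phi \o line) x) ('D_v (Phi \o line) x)
        = g_St x u v].

(* nu is the pullback of omega1 /\ omega2 /\ psi by Phi. *)
Definition corresponds_to_SO3_volume (Phi : RP3 R -> 'M[R]_3) (nu : form R) : Prop :=
  forall x u v w, x != 0 ->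
    u \in tangent x -> v \in tangent x -> w \in tangent x ->
    nu x u v w =
      wedge3 (omega1 (Phi (line x))) (omega2 (Phi (line x))) (psi (Phi (line x)))
        ('D_u (Phi \o line) x) ('D_v (Phi \o line) x) ('D_w (Phi \o line) x).

End SO3.

Section Equiaffine.
Context {R : realType}.

(* The triples (RP^3, nabla, nu) for which equiaffine immersions are defined. *)
Record equiaffine_structure := EquiaffineStructure {
  ea_nabla : operator R;
  ea_nu : form R;
  ea_connection : linear_connection ea_nabla;
  ea_torsion_free : torsion_free ea_nabla;
  ea_volume_form : volume_form ea_nu;
  ea_parallel : parallel ea_nabla ea_nu }.

(* T i at the point line x, on the tangent vector v represented at x *)
Definition Ti (i : RP3 R -> 'rV[R]_4) (x : 'rV[R]_4) : 'Hom('rV[R]_4, 'rV[R]_4) :=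
  linfun ('d (i \o line) x).

Definition Ti_image (i : RP3 R -> 'rV[R]_4) (x : 'rV[R]_4) : {vspace 'rV[R]_4} :=
  (Ti i x @: tangent x)%VS.

Definition immersion (i : RP3 R -> 'rV[R]_4) : Prop :=
  smooth_on_RP3 i /\
  forall x, x != 0 -> (lker (Ti i x) :&: tangent x = 0)%VS.

Definition transversal (i : RP3 R -> 'rV[R]_4) (l : RP3 R -> RP3 R) : Prop :=
  smooth_into_RP3 punctured (l \o line) /\
  forall x, x != 0 ->
    (Ti_image i x + val (l (line x)) = fullv)%VS /\
    (Ti_image i x :&: val (l (line x)) = 0)%VS.

(* daddv_pi U V is the projection onto U along V. *)
Definition induced_connection (i : RP3 R -> 'rV[R]_4) (l : RP3 R -> RP3 R)
    (nabla : operator R) : Prop :=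
  forall xi eta x, vector_field xi -> vector_field eta -> x != 0 ->
    Ti i x (nabla xi eta x) =
      daddv_pi (Ti_image i x) (val (l (line x)))
        (along xi (fun y => Ti i y (eta y)) x).

Definition equiaffine_immersion (E : equiaffine_structure)
    (i : RP3 R -> 'rV[R]_4) (l : RP3 R -> RP3 R) : Prop :=
  [/\ immersion i, transversal i l & induced_connection i l (ea_nabla E)].

End Equiaffine.

Arguments equiaffine_structure : clear implicits.

(* Main.v *)
From HB Require Import structures.
Require Import Defs.
From mathcomp Require Import all_boot all_order all_algebra.
From mathcomp Require Import all_classical all_reals all_analysis.
From mathcomp Require Import ring lra.

(** Read through the quaternions, R^4 carries the linear vector fields
    X_1, X_2, X_3 of right multiplication by i, j, k; they descend to an
    orthonormal frame of RP^3 with nabla_(X_1) X_2 = X_3 (cyclically).  For an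
    equiaffine immersion F, the vectors X_i X_j F - (nabla_(X_i) X_j) F lie in
    the normal line, so they are pairwise proportional.  Differentiating this
    proportionality and comparing with the commutators of the frame (the Gauss
    and Codazzi equations) forces the affine fundamental form to be a multiple
    of the metric: since the metric has constant nonzero curvature, the
    immersion is umbilic.  Hence every coordinate f of F satisfies
    X_1 X_1 X_1 f = - X_1 f.  Along the great circle tangent to X_1 the function
    X_1 f is thus a combination of cos and sin, so it changes sign at the
    antipodal point; as f is even, it does not.  So X_1 f = 0, and F is not an
    immersion. *)

Set Implicit Arguments.
Unset Strict Implicit.
Unset Printing Implicit Defensive.

Import Order.TTheory GRing.Theory Num.Theory.
Import numFieldNormedType.Exports.

Local Open Scope classical_set_scope.
Local Open Scope ring_scope.

(** * Differential calculus *)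

Section Differentiable.
Context {R : realType} {V W : normedModType R}.

(** The first-order expansion of [f] at [x] is also one of [g], as the two agree near [x];
    uniqueness of the differential then identifies ['d g x] with ['d f x]. *)
Lemma near_eq_differentiable (f g : V -> W) (x : V) :
  (\forall y \near x, f y = g y) -> differentiable f x -> differentiable g x.
Proof.
move=> fg df.
have gE : g \o shift x = cst (g x) + 'd f x +o_ 0 id.
  apply/eqaddoP => e e0; have /diff_locally/eqaddoP/(_ e e0) := df.
  have fg0 : \forall y \near 0, f (y + x) = g (y + x).
    by move: fg; rewrite (near_shift 0) /=; apply: filterS => y; rewrite /= subr0.
  apply: filter_app; apply: filterS fg0 => y /= yfg.
  by rewrite !fctE /= yfg (nbhs_singleton fg).
have dg : 'd g x = 'd f x :> (V -> W).
  by apply: diff_unique gE; exact: diff_continuous.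
by apply/diff_locallyP; rewrite dg; split=> //; exact: diff_continuous.
Qed.

End Differentiable.

Section Smoothness.
Context {R : realType} {V : normedModType R}.
Implicit Types (U : set V) (k : nat).

(** Since [U] is open, a derivative at a point of [U] sees only values taken in [U], so the equality
    passes to all directional derivatives. *)
Lemma Ck_on_eq (W : normedModType R) k U (f g : V -> W) :
  open U -> (forall x, U x -> f x = g x) -> Ck_on k U f -> Ck_on k U g.
Proof.
move=> oU; elim: k f g => [|k IH] f g fg /=.
  move=> cf x Ux; have := cf x Ux.
  rewrite /prop_for /continuous_at (fg x Ux) => cfx.
  apply: cvg_trans cfx; apply: near_eq_cvg.
  by apply: filterS (open_nbhs_nbhs (conj oU Ux)) => y /fg.
move=> [df Cf]; split.
  move=> x Ux; have := df x Ux.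
  apply: near_eq_differentiable.
  by apply: filterS (open_nbhs_nbhs (conj oU Ux)) => y /fg.
move=> v; apply: IH (Cf v) => x Ux.
apply: near_eq_derive.
by apply: filterS (open_nbhs_nbhs (conj oU Ux)) => y /fg.
Qed.

Lemma Ck_onW (W : normedModType R) k U (f : V -> W) :
  Ck_on k.+1 U f -> Ck_on k U f.
Proof.
elim: k f => [|k IH] f /=.
  by move=> [df _] x Ux; exact/differentiable_continuous/df.
by move=> [df Cf]; split=> // v; apply: IH; exact: Cf.
Qed.

Lemma Ck_on_cst (W : normedModType R) k U (c : W) : Ck_on k U (cst c : V -> W).
Proof.
elim: k c => [|k IH] c /=; first by move=> x _; exact: cvg_cst.
split; first by move=> x _; exact: differentiable_cst.
move=> v; rewrite (_ : 'D_v (cst c) = cst 0); first exact: IH.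
by apply/funext => x; rewrite derive_cst.
Qed.

Lemma Ck_onD (W : normedModType R) k U (f g : V -> W) :
  open U -> Ck_on k U f -> Ck_on k U g -> Ck_on k U (fun x => f x + g x).
Proof.
move=> oU; elim: k f g => [|k IH] f g /=.
  by move=> cf cg x Ux; apply: cvgD; [exact: cf|exact: cg].
move=> [df Cf] [dg Cg]; split.
  by move=> x Ux; apply: differentiableD; [exact: df|exact: dg].
move=> v; apply: (Ck_on_eq oU _ (IH _ _ (Cf v) (Cg v))) => x Ux /=.
by rewrite deriveD //; apply: diff_derivable; [exact: df|exact: dg].
Qed.

Lemma Ck_on_sum (W : normedModType R) k U n (f : 'I_n -> V -> W) :
  open U -> (forall i, Ck_on k U (f i)) -> Ck_on k U (fun x => \sum_i f i x).
Proof.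
move=> oU Cf.
rewrite (_ : (fun x => _) = \sum_i f i); last by apply/funext=> x; rewrite fct_sumE.
elim/big_ind : _ => //; first exact: (Ck_on_cst k U (0 : W)).
by move=> g h Cg Ch; exact: (Ck_onD oU Cg Ch).
Qed.

Lemma Ck_onM k U (f g : V -> R) :
  open U -> Ck_on k U f -> Ck_on k U g -> Ck_on k U (fun x => f x * g x).
Proof.
move=> oU; elim: k f g => [|k IH] f g.
  by move=> cf cg x Ux; apply: cvgM; [exact: cf|exact: cg].
move=> Cf Cg; have [[df Df] [dg Dg]] := (Cf, Cg); split.
  by move=> x Ux; apply: differentiableM; [exact: df|exact: dg].
move=> v; apply: (Ck_on_eq oU _ (Ck_onD oU (IH _ _ (Ck_onW Cf) (Dg v))
  (IH _ _ (Ck_onW Cg) (Df v)))) => x Ux /=.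
by rewrite deriveM //; apply: diff_derivable; [exact: df|exact: dg].
Qed.

End Smoothness.

Section Curves.
Context {R : realType} {V : normedModType R}.

Lemma is_derive_curve (W : normedModType R) (f : V -> W) (c : R -> V) (t : R) (dc : V) :
  is_derive t (1 : R) c dc -> differentiable f (c t) ->
  is_derive t (1 : R) (f \o c) ('D_dc f (c t)).
Proof.
move=> [dct <-] df.
have dc' : differentiable c t by apply/derivable1_diffP.
have dfc : differentiable (f \o c) t by exact: differentiable_comp.
split; first exact: diff_derivable.
by rewrite [LHS]deriveE // diff_comp //= [RHS]deriveE // deriveE.
Qed.

Lemma is_derive_scalel (k : R -> R) (t dk : R) (v : V) :
  is_derive t (1 : R) k dk -> is_derive t (1 : R) (fun s => k s *: v) (dk *: v).
Proof.
move=> [dkt <-].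
have dk' : differentiable k t by apply/derivable1_diffP.
have dkv := differentiableZl v dk'.
split; first exact: diff_derivable.
by rewrite deriveE // diffZl // deriveE.
Qed.

Lemma is_derive_line (x v : V) (t : R) :
  is_derive t (1 : R) (fun s : R => x + s *: v) v.
Proof.
have := is_derive_scalel v (is_derive_id t (1 : R)).
rewrite scale1r => /(is_deriveD (is_derive_cst x t 1)).
by rewrite add0r.
Qed.

End Curves.

(** * Symmetry of second derivatives *)

Section Schwarz.
Context {R : realType}.

Lemma MVT_cc (g dg : R -> R) (s : R) :
  0 < s -> (forall t, t \in `[0, s] -> is_derive t 1 g (dg t)) ->
  exists2 t, t \in `[0, s] & g s - g 0 = dg t * s.
Proof.
move=> s0 gdg.
have H1 : forall t, t \in `]0, s[%R -> is_derive t 1 g (dg t).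
  by move=> t tI; apply: gdg; exact: subset_itv_oo_cc.
have H2 : {within `[0, s], continuous g}.
  by apply: derivable_within_continuous => t /gdg[].
by have := @MVT_segment R g dg 0 s (ltW s0) H1 H2; rewrite subr0.
Qed.

Context {V : normedModType R}.

(* The second difference below is symmetric in u and v, whence Schwarz's theorem. *)
Lemma second_difference (U : set V) (f : V -> R) (x u v : V) (e : R) :
  open U -> Ck_on 2 U f -> U x -> 0 < e ->
  exists2 d : R, 0 < d & forall s, 0 < s -> s < d ->
    `|f (x + s *: u + s *: v) - f (x + s *: u) - (f (x + s *: v) - f x)
      - 'D_v ('D_u f) x * s * s| <= e * s * s.
Proof.
move=> oU [df D1f] Ux e0; have [dDf D2f] := D1f u.
have cf : {for x, continuous ('D_v ('D_u f))} by exact: D2f.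
move/cvgrPdist_le : cf => /(_ e e0).
have := open_nbhs_nbhs (conj oU Ux).
move=> /nbhs_ballP[r1 /= r10 Br1] /nbhs_ballP[r2 /= r20 Br2].
pose r := Num.min r1 r2; have r0 : 0 < r by rewrite lt_min r10 r20.
(* For [s < r / m] all points [x + a *: u + b *: v] with [a], [b] between [0] and [s] lie in the
   ball of radius [r], because [s * m < r]. *)
pose m := `|u| + `|v| + 1; have m0 : 0 < m by rewrite ltr_wpDl ?addr_ge0.
exists (r / m); first exact: divr_gt0.
move=> s s0 sd.
have Br a b : a \in `[0, s] -> b \in `[0, s] -> ball x r (x + a *: u + b *: v).
  rewrite !in_itv /= => /andP[a0 as_] /andP[b0 bs].
  rewrite -ball_normE /= -addrA opprD addrA subrr sub0r normrN.
  apply: (le_lt_trans (ler_normD _ _)); rewrite !normrZ !ger0_norm //.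
  apply: (@lt_trans _ _ (s * m)); last by rewrite -ltr_pdivlMr.
  rewrite /m !mulrDr mulr1.
  by have := lerD (ler_wpM2r (normr_ge0 u) as_) (ler_wpM2r (normr_ge0 v) bs); lra.
have UB a b : a \in `[0, s] -> b \in `[0, s] -> U (x + a *: u + b *: v).
  move=> aI bI; apply: Br1; apply: le_ball (Br a b aI bI).
  by rewrite ge_min lexx.
have I0 : 0 \in `[0, s] by rewrite in_itv /= lexx ltW.
have Is : s \in `[0, s] by rewrite in_itv /= lexx ltW.
have dline (h : V -> R) (b : R) : (forall y, U y -> differentiable h y) -> b \in `[0, s] ->
    forall a, a \in `[0, s] ->
    is_derive a 1 (fun a : R => h (x + a *: u + b *: v)) ('D_u h (x + a *: u + b *: v)).
  move=> dh bI a aI.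
  have E c : x + c *: u + b *: v = (x + b *: v) + c *: u by rewrite addrAC.
  under eq_fun do rewrite E; rewrite E.
  by apply: is_derive_curve; [exact: is_derive_line|rewrite -E; exact/dh/UB].
(* Mean value theorem in direction [u], applied to the difference in direction [v]. A second
   application, to ['D_u f] in direction [v], turns the second difference into a mixed derivative at
   an intermediate point times [s * s]. *)
have [a aI Ea] := @MVT_cc
  (fun a => f (x + a *: u + s *: v) - f (x + a *: u + (0 : R) *: v))
  (fun a => 'D_u f (x + a *: u + s *: v) - 'D_u f (x + a *: u + (0 : R) *: v)) s s0
  (fun a aI => is_deriveB (dline f s df Is a aI) (dline f 0 df I0 a aI)).
have dv b : b \in `[0, s] -> is_derive b 1
    (fun b : R => 'D_u f (x + a *: u + b *: v)) ('D_v ('D_u f) (x + a *: u + b *: v)).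
  by move=> bI; apply: is_derive_curve; [exact: is_derive_line|exact/dDf/UB].
have [b bI Eb] := @MVT_cc (fun b => 'D_u f (x + a *: u + b *: v)) _ s s0 dv.
move: Ea; rewrite /= Eb !scale0r !addr0 => ->.
rewrite -!mulrBl !normrM (gtr0_norm s0) ler_pM2r // ler_pM2r // distrC.
apply: Br2; apply: le_ball (Br a b aI bI).
by rewrite ge_min lexx orbT.
Qed.

Lemma derive_sym (U : set V) (f : V -> R) (x u v : V) :
  open U -> Ck_on 2 U f -> U x -> 'D_v ('D_u f) x = 'D_u ('D_v f) x.
Proof.
move=> oU Cf Ux; apply/eqP; rewrite -subr_eq0 -normr_le0.
apply/ler_addgt0Pr => e e0; rewrite add0r; have e20 : 0 < e / 2 by exact: divr_gt0.
have [d1 d10 H1] := second_difference u v oU Cf Ux e20.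
have [d2 d20 H2] := second_difference v u oU Cf Ux e20.
pose s := Num.min d1 d2 / 2.
have m0 : 0 < Num.min d1 d2 by rewrite lt_min d10.
have s0 : 0 < s by exact: divr_gt0.
have sm : s < Num.min d1 d2 by rewrite ltr_pdivrMr // ltr_pMr // ltr1n.
have [sd1 sd2] : s < d1 /\ s < d2 by move: sm; rewrite lt_min => /andP.
have := H2 s s0 sd2; rewrite (addrAC x (s *: v)); move: (H1 s s0 sd1).
move: (f _) (f _) (f _) (f _) ('D_v _ x) ('D_u _ x) => A B C D P Q h1 h2.
have ss0 : 0 < s * s by exact: mulr_gt0.
rewrite -(ler_pM2r ss0) -[s * s in leLHS]gtr0_norm // -normrM.
(* Both estimates concern the same second difference, each with error at most [e / 2 * s * s];
   subtracting them leaves only the mixed derivatives. *)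
have -> : (P - Q) * (s * s) =
    (D - B - (C - A) - Q * s * s) - (D - C - (B - A) - P * s * s) by ring.
apply: (le_trans (ler_normB _ _)); apply: (le_trans (lerD h2 h1)).
by lra.
Qed.

End Schwarz.

Section Coordinates.
Context {R : realType} {V : normedModType R}.

Lemma derive_coord m (F : V -> 'rV[R]_m) x v j :
  derivable F x v -> 'D_v (fun x => F x 0 j) x = 'D_v F x 0 j.
Proof. by move=> dF; rewrite derive_mx // mxE. Qed.

Lemma Ck_on_coord k (U : set V) m (F : V -> 'rV[R]_m) j :
  open U -> Ck_on k U F -> Ck_on k U (fun x => F x 0 j).
Proof.
move=> oU; elim: k F => [|k IH] F /=.
  move=> cF x Ux; apply: (@continuous_comp _ _ _ F (fun M : 'rV[R]_m => M 0 j)).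
    exact: cF.
  exact: coord_continuous.
move=> [dF DF]; split.
  move=> x Ux; apply: (@differentiable_comp _ _ _ _ F (fun M : 'rV[R]_m => M 0 j)).
    exact: dF.
  exact: differentiable_coord.
move=> v; apply: (Ck_on_eq oU _ (IH _ (DF v))) => x Ux.
by rewrite derive_coord //; exact/diff_derivable/dF.
Qed.

Lemma differentiable_rowP m (F : V -> 'rV[R]_m) x :
  (forall j, differentiable (fun y => F y 0 j) x) -> differentiable F x.
Proof.
move=> dF.
rewrite (_ : F = \sum_j (fun y => F y 0 j *: delta_mx 0 j)); last first.
  by apply/funext => y; rewrite fct_sumE {1}(row_sum_delta (F y)).
by apply: differentiable_sum => j; exact: differentiableZl.
Qed.

End Coordinates.

(* Sealed: otherwise unification and [ring] unfold derivatives into limits. *)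
HB.lock Definition DX (R : realType) (n : nat) (A : 'M[R]_n) (f : 'rV[R]_n -> R)
  (x : 'rV[R]_n) : R := 'D_(x *m A) f x.
Canonical DX_unlockable := Unlockable DX.unlock.

(** * Derivatives along linear vector fields *)

Section RowVectors.
Context {R : realType} {n : nat}.

Implicit Types (A B : 'M[R]_n) (U : set 'rV[R]_n).

Lemma is_derive_mulmx_coord A (j : 'I_n) (x v : 'rV[R]_n) :
  is_derive x v (fun y : 'rV[R]_n => (y *m A) 0 j) ((v *m A) 0 j).
Proof.
have E : \forall h \near (0 : R)^',
    h^-1 *: (((fun y : 'rV[R]_n => (y *m A) 0 j) \o shift x) (h *: v) - (x *m A) 0 j)
    = (v *m A) 0 j.
  near=> h; have h0 : h != 0 by near: h; exact: nbhs_dnbhs_neq.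
  rewrite /= mulmxDl -scalemxAl mxE addrK mxE -[_ *: _]/(_ * _).
  by rewrite mulKf.
split; first exact: is_cvg_near_cst E.
exact: lim_near_cst E.
Unshelve. all: by end_near. Qed.

Lemma Ck_on_mulmx_coord A (j : 'I_n) k U :
  Ck_on k U (fun y : 'rV[R]_n => (y *m A) 0 j).
Proof.
(* Order [k.+1] is proved instead: the directional derivatives are constant, which replaces an
   induction on [k]. *)
apply: Ck_onW; split.
  move=> x _.
  rewrite (_ : (fun y => _) = \sum_i (fun y : 'rV[R]_n => y 0 i * A i j)); last first.
    by apply/funext => y; rewrite fct_sumE mxE.
  apply: differentiable_sum => i.
  apply: differentiableM; first exact: differentiable_coord.
  exact: differentiable_cst.
move=> v; rewrite (_ : 'D_v _ = cst ((v *m A) 0 j)); first exact: Ck_on_cst.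
by apply/funext => x; have [] := is_derive_mulmx_coord A j x v.
Qed.

Implicit Types (f g : 'rV[R]_n -> R) (x : 'rV[R]_n).

Lemma derive_mulmx A (x v : 'rV[R]_n) : 'D_v (fun y : 'rV[R]_n => y *m A) x = v *m A.
Proof.
rewrite derive_mx; last first.
  by apply/derivable_mxP => i j; rewrite ord1; case: (is_derive_mulmx_coord A j x v).
by apply/rowP => j; rewrite mxE; case: (is_derive_mulmx_coord A j x v).
Qed.

Lemma smooth_on_mulmx A U : smooth_on U (fun y : 'rV[R]_n => y *m A).
Proof.
move=> k; apply: Ck_onW; split.
  move=> x Ux; apply: differentiable_rowP => j.
  by have [+ _] := Ck_on_mulmx_coord A j 1 U; apply.
move=> v; rewrite (_ : 'D_v _ = cst (v *m A)); first exact: Ck_on_cst.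
by apply/funext => x; exact: derive_mulmx.
Qed.

Lemma DX_def A f x : DX A f x = 'D_(x *m A) f x. Proof. by rewrite unlock. Qed.

Lemma DX_cst A (c : R) x : DX A (cst c) x = 0.
Proof. by rewrite !DX_def derive_cst. Qed.

(** Reduces [DX A], whose direction moves with the point, to derivatives in fixed directions, the
    only ones that [Ck_on] speaks about. *)
Lemma DXE A f x : differentiable f x ->
  DX A f x = \sum_j (x *m A) 0 j * 'D_(delta_mx 0 j) f x.
Proof.
move=> df; rewrite !DX_def {1}(row_sum_delta (x *m A)) deriveE // linear_sum.
by apply: eq_bigr => j _; rewrite linearZ /= deriveE.
Qed.

Lemma Ck_on_DX A k U f : open U -> Ck_on k.+1 U f -> Ck_on k U (DX A f).
Proof.
move=> oU [df Df].
apply: (Ck_on_eq oU (fun x Ux => esym (DXE A (df x Ux)))).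
apply: Ck_on_sum => // j; apply: Ck_onM => //; first exact: Ck_on_mulmx_coord.
exact: Df.
Qed.

Lemma smooth_on_DX A U f : open U -> smooth_on U f -> smooth_on U (DX A f).
Proof. by move=> oU sf k; exact/Ck_on_DX/sf. Qed.

Lemma smooth_on_differentiable U (f : 'rV[R]_n -> R) x :
  smooth_on U f -> U x -> differentiable f x.
Proof. by move=> /(_ 1) [+ _]; apply. Qed.

Lemma DX_eq A U f g x : open U -> (forall y, U y -> f y = g y) -> U x ->
  DX A f x = DX A g x.
Proof.
move=> oU fg Ux; rewrite !DX_def; apply: near_eq_derive.
by apply: filterS (open_nbhs_nbhs (conj oU Ux)) => y /fg.
Qed.

Lemma DXD A f g x : differentiable f x -> differentiable g x ->
  DX A (fun y => f y + g y) x = DX A f x + DX A g x.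
Proof. by move=> df dg; rewrite !DX_def deriveD //; exact: diff_derivable. Qed.

Lemma DXB A f g x : differentiable f x -> differentiable g x ->
  DX A (fun y => f y - g y) x = DX A f x - DX A g x.
Proof. by move=> df dg; rewrite !DX_def deriveB //; exact: diff_derivable. Qed.

Lemma DXM A f g x : differentiable f x -> differentiable g x ->
  DX A (fun y => f y * g y) x = f x * DX A g x + g x * DX A f x.
Proof. by move=> df dg; rewrite !DX_def deriveM //; exact: diff_derivable. Qed.

Lemma DXDmx A B f x : differentiable f x -> DX (A + B) f x = DX A f x + DX B f x.
Proof. by move=> df; rewrite !DX_def mulmxDr !deriveE // linearD. Qed.

Lemma DXNmx A f x : differentiable f x -> DX (- A) f x = - DX A f x.
Proof. by move=> df; rewrite !DX_def mulmxN !deriveE // linearN. Qed.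

(** By the product rule, [DX C (DX D f) x] is [DX (C *m D) f x] plus [S C D], the second derivative
    of [f] on the pair [x *m C], [x *m D]. The latter is symmetric by Schwarz's theorem, so only the
    matrix commutator survives. *)
Lemma DX_comm A B U f x : open U -> smooth_on U f -> U x ->
  DX A (DX B f) x - DX B (DX A f) x = DX (A *m B - B *m A) f x.
Proof.
move=> oU sf Ux; have df := smooth_on_differentiable sf Ux.
pose S C D := \sum_i \sum_j (x *m C) 0 i * (x *m D) 0 j
  * 'D_(delta_mx 0 i) ('D_(delta_mx 0 j) f) x.
have main C D : DX C (DX D f) x = DX (C *m D) f x + S C D.
  have dDf j : differentiable ('D_(delta_mx 0 j) f) x.
    by have [_ /(_ (delta_mx 0 j)) [+ _]] := sf 2%N; apply.
  rewrite (DX_eq C oU (fun y Uy => DXE D (smooth_on_differentiable sf Uy)) Ux).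
  rewrite !DX_def.
  rewrite (_ : (fun y => _) = \sum_j (fun y : 'rV_n => (y *m D) 0 j)
      * 'D_(delta_mx 0 j) f); last first.
    by apply/funext=> y; rewrite fct_sumE.
  have dMj j := is_derive_mulmx_coord D j x (x *m C).
  have dDj j : is_derive x (x *m C) ('D_(delta_mx 0 j) f)
      ('D_(x *m C) ('D_(delta_mx 0 j) f) x).
    exact/derivableP/diff_derivable/dDf.
  rewrite derive_sum; last by move=> j; apply: derivableM => //; case: (dMj j).
  under eq_bigr => j _.
    rewrite (@derive_val _ _ _ _ _ _ _ (is_deriveM (dMj j) (dDj j))).
    rewrite -mulmxA.
    over.
  rewrite big_split /= addrC; congr (_ + _).
    rewrite -DX_def DXE //; apply: eq_bigr => j _.
    by rewrite -[_ *: _]/(_ * _) mulrC.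
  rewrite /S exchange_big /=; apply: eq_bigr => j _.
  rewrite -DX_def DXE // -[_ *: _]/(_ * _) mulr_sumr; apply: eq_bigr => i _.
  by rewrite mulrA (mulrC ((x *m D) 0 j)).
have symS : S A B = S B A.
  rewrite /S exchange_big /=; apply: eq_bigr => i _; apply: eq_bigr => j _.
  by rewrite (derive_sym _ _ oU (sf 2%N) Ux) (mulrC ((x *m A) 0 j)).
by rewrite !main symS opprD addrACA subrr addr0 DXDmx // DXNmx.
Qed.

End RowVectors.

(** * The quaternionic frame and its Levi-Civita connection *)

Section Algebra.
Context {F : fieldType} {V : lmodType F}.

(** A relation [p *: s1 + q *: s2 = 0] makes the pair [p], [q] parallel to [a], [b], so [p *: t1]
    and [q *: t1] are multiples of that relation and vanish. *)
Lemma free_pair_span (s1 s2 t1 t2 : V) (a b c d p q : F) :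
  (forall u v : F, u *: t1 + v *: t2 = 0 -> u = 0 /\ v = 0) ->
  a *: s1 + b *: s2 = t1 -> c *: s1 + d *: s2 = t2 ->
  p *: s1 + q *: s2 = 0 -> p = 0 /\ q = 0.
Proof.
move=> free t1E t2E rel.
have E1 : (p * d - q * c) *: t1 + (q * a - p * b) *: t2 = 0.
  rewrite -t1E -t2E.
  transitivity ((a * d - b * c) *: (p *: s1 + q *: s2)); last by rewrite rel scaler0.
  rewrite !scalerDr !scalerA addrACA -!scalerDl.
  by congr (_ *: _ + _ *: _); ring.
have [k1 k2] := free _ _ E1.
have pb : p * b = q * a by apply/esym/eqP; rewrite -subr_eq0 k2.
have [|-> _] := free p 0.
  by rewrite scale0r addr0 -t1E scalerDr !scalerA pb !(mulrC _ a) -!scalerA -scalerDr rel scaler0.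
have [|-> _] := free q 0; last by [].
by rewrite scale0r addr0 -t1E scalerDr !scalerA -pb !(mulrC _ b) -!scalerA -scalerDr rel scaler0.
Qed.

(** Modulo the normal line, [t1], [t2], [t3] stand for the tangent frame and [n1], [n2], [n3] for
    the derivatives of a normal direction; [p1], [p2], [p3] are the diagonal and [q1], [q2], [q3]
    the off-diagonal entries of the affine fundamental form. As [t1], [t2] lie in the span of [n1],
    [n2], these are independent, and the third equation kills [q1] and [q2]; likewise [n2], [n3]
    give [q3 = 0]. Then [t3] is both [- p1 *: n3] and [- p2 *: n3], with [n3] nonzero. *)
Lemma codazzi_linear (n1 n2 n3 t1 t2 t3 : V) (p1 p2 p3 q1 q2 q3 : F) :
  (forall u v : F, u *: t2 + v *: t1 = 0 -> u = 0 /\ v = 0) ->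
  (forall u v : F, u *: t3 + v *: t2 = 0 -> u = 0 /\ v = 0) ->
  [/\ q3 *: n1 - p1 *: n2 = t2, p2 *: n1 - q3 *: n2 = - t1 & q1 *: n1 - q2 *: n2 = 0] ->
  [/\ q1 *: n2 - p2 *: n3 = t3, p3 *: n2 - q1 *: n3 = - t2 & q2 *: n2 - q3 *: n3 = 0] ->
  p1 *: n3 - q2 *: n1 = - t3 ->
  [/\ q3 = 0, q1 = 0 & p1 = p2].
Proof.
move=> free21 free32 [a1 a2 a3] [b1 b2 b3] c2.
have [q1_0 /eqP] : q1 = 0 /\ - q2 = 0.
  apply: (free_pair_span free21 (s1 := n1) (s2 := n2) (a := q3) (b := - p1) (c := - p2) (d := q3)).
  - by rewrite scaleNr.
  - by rewrite -[RHS]opprK -a2 scaleNr opprB addrC.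
  - by rewrite scaleNr.
rewrite oppr_eq0 => /eqP q2_0.
have [_ /eqP] : q2 = 0 /\ - q3 = 0.
  apply: (free_pair_span free32 (s1 := n2) (s2 := n3) (a := q1) (b := - p2) (c := - p3) (d := q1)).
  - by rewrite scaleNr.
  - by rewrite -[RHS]opprK -b2 scaleNr opprB addrC.
  - by rewrite scaleNr.
rewrite oppr_eq0 => /eqP q3_0; split=> //.
move: c2; rewrite -b1 q1_0 q2_0 !scale0r sub0r subr0 => /eqP.
rewrite opprK -subr_eq0 -scalerBl scaler_eq0 subr_eq0 => /orP[/eqP //|/eqP n3_0].
have [|/eqP] := free32 1 0; last by rewrite oner_eq0.
by rewrite -b1 n3_0 q1_0 !scale0r scaler0 subr0 addr0 scaler0.
Qed.

End Algebra.

(** * Quaternionic triples of skew matrices *)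

Section Quaternions.
Context {R : realType}.
Implicit Types (A B C I J K : 'M[R]_4) (x u v : 'rV[R]_4).

(** The relations are invariant under cyclic rotation, so a fact proved for one triple transfers to
    [J K I] and [K I J]. *)
Record quaternionic I J K : Prop := {
  quat_II : I *m I = - 1%:M;
  quat_JJ : J *m J = - 1%:M;
  quat_KK : K *m K = - 1%:M;
  quat_IJ : I *m J = K;
  quat_JK : J *m K = I;
  quat_KI : K *m I = J;
  quat_I : I^T = - I;
  quat_J : J^T = - J;
  quat_K : K^T = - K }.

Lemma quaternionic_rot I J K : quaternionic I J K -> quaternionic J K I.
Proof. by case. Qed.

Lemma quat_JI I J K : quaternionic I J K -> J *m I = - K.
Proof.
case=> _ _ _ IJ _ _ It Jt Kt.
by rewrite -Kt -IJ trmx_mul It Jt mulNmx mulmxN opprK.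
Qed.

Lemma dotC u v : dot u v = dot v u.
Proof. by rewrite /dot -[in LHS](trmxK u) -trmx_mul mxE. Qed.

Lemma dotNl u v : dot (- u) v = - dot u v.
Proof. by rewrite /dot mulNmx mxE. Qed.

Lemma dotNr u v : dot u (- v) = - dot u v.
Proof. by rewrite dotC dotNl dotC. Qed.

Lemma dotDl u u' v : dot (u + u') v = dot u v + dot u' v.
Proof. by rewrite /dot mulmxDl mxE. Qed.

Lemma dotBl u u' v : dot (u - u') v = dot u v - dot u' v.
Proof. by rewrite dotDl dotNl. Qed.

Lemma dotZl (k : R) u v : dot (k *: u) v = k * dot u v.
Proof. by rewrite /dot -scalemxAl mxE. Qed.

Lemma dot0l v : dot 0 v = 0.
Proof. by rewrite /dot mul0mx mxE. Qed.

Lemma dot_mulmx A u v : dot (u *m A) v = dot u (v *m A^T).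
Proof. by rewrite /dot trmx_mul trmxK mulmxA. Qed.

Lemma dot_skew A x : A^T = - A -> dot x (x *m A) = 0.
Proof.
move=> At; have := dot_mulmx A x x.
rewrite At mulmxN dotNr dotC => /eqP.
by rewrite -subr_eq0 opprK -mulr2n mulrn_eq0 => /eqP.
Qed.

Lemma sum4E (f : 'I_4 -> R) : \sum_i f i = f 0 + f 1 + f 2%:R + f 3%:R.
Proof.
rewrite !big_ord_recl big_ord0 addr0 !addrA.
by do !congr (_ + _); congr (f _); apply: val_inj.
Qed.

Lemma row4P u v :
  u 0 0 = v 0 0 -> u 0 1 = v 0 1 -> u 0 2%:R = v 0 2%:R -> u 0 3%:R = v 0 3%:R -> u = v.
Proof.
move=> e0 e1 e2 e3; apply/rowP; case=> -[|[|[|[|//]]]] lt.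
- by rewrite (_ : Ordinal lt = 0) //; exact: val_inj.
- by rewrite (_ : Ordinal lt = 1) //; exact: val_inj.
- by rewrite (_ : Ordinal lt = 2%:R) //; exact: val_inj.
- by rewrite (_ : Ordinal lt = 3%:R) //; exact: val_inj.
Qed.

Lemma quat_dot_diag I J K x : quaternionic I J K -> dot (x *m I) (x *m I) = dot x x.
Proof.
by case=> II _ _ _ _ _ It _ _; rewrite dot_mulmx It -mulmxA mulmxN II opprK mulmx1.
Qed.

Lemma quat_dot_off I J K x : quaternionic I J K -> dot (x *m J) (x *m I) = 0.
Proof.
case=> _ _ _ IJ _ _ _ Jt Kt.
by rewrite dot_mulmx Jt mulmxN -mulmxA IJ dotNr dot_skew ?oppr0.
Qed.

Lemma dotE u v :
  dot u v = u 0 0 * v 0 0 + u 0 1 * v 0 1 + u 0 2%:R * v 0 2%:R + u 0 3%:R * v 0 3%:R.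
Proof. by rewrite /dot mxE sum4E !mxE. Qed.

Lemma dot_gt0 x : x != 0 -> 0 < dot x x.
Proof.
move=> x0; rewrite lt_neqAle dotE -!expr2 !addr_ge0 ?sqr_ge0 // andbT.
apply: contra x0; rewrite eq_sym !paddr_eq0 ?addr_ge0 ?sqr_ge0 // !sqrf_eq0.
move=> /andP[/andP[/andP[/eqP x0 /eqP x1] /eqP x2] /eqP x3].
by apply/eqP/row4P; rewrite mxE.
Qed.

Lemma tangentE x u : (u \in tangent x) = (dot u x == 0).
Proof.
rewrite memv_ker lfunE /=; apply/eqP/eqP => [E|]; first by rewrite /dot E mxE.
by move=> E; apply/matrixP => i j; rewrite !ord1 [RHS]mxE.
Qed.

Definition mx4 (s : seq (seq R)) : 'M[R]_4 := \matrix_(i, j) nth 0 (nth [::] s i) j.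

(* Right multiplication by the quaternions i, j, k on R^4 = H. *)
Definition quatI := mx4
  [:: [:: 0; 1; 0; 0]; [:: -1; 0; 0; 0]; [:: 0; 0; 0; -1]; [:: 0; 0; 1; 0]].
Definition quatJ := mx4
  [:: [:: 0; 0; 1; 0]; [:: 0; 0; 0; 1]; [:: -1; 0; 0; 0]; [:: 0; -1; 0; 0]].
Definition quatK := mx4
  [:: [:: 0; 0; 0; 1]; [:: 0; 0; -1; 0]; [:: 0; 1; 0; 0]; [:: -1; 0; 0; 0]].

Lemma quaternionic_std : quaternionic quatI quatJ quatK.
Proof.
split; apply/matrixP => i j; rewrite !mxE ?sum4E ?mxE;
case: i => -[|[|[|[|//]]]] ?; case: j => -[|[|[|[|//]]]] ? /=; ring.
Qed.

(** The vectors [x], [x *m quatI], [x *m quatJ], [x *m quatK] are orthogonal of equal length, so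
    their matrix has its transpose as inverse up to the factor [dot x x]. Each coordinate of [v]
    times that factor is thus an explicit combination of the four vanishing products. *)
Lemma quaternionic_total x v : x != 0 -> dot v x = 0 ->
  dot v (x *m quatI) = 0 -> dot v (x *m quatJ) = 0 -> dot v (x *m quatK) = 0 ->
  v = 0.
Proof.
move=> /dot_gt0 /lt0r_neq0; rewrite !dotE !mxE !sum4E !mxE /=.
set N := (X in X != 0) => N0 h hI hJ hK.
have cancel (r : R) : r * N = 0 -> r = 0 by move/eqP; rewrite mulf_eq0 (negPf N0) orbF => /eqP.
move: h hI hJ hK; set x0 := x 0 0; set x1 := x 0 1; set x2 := x 0 2%:R; set x3 := x 0 3%:R.
set e := (X in X = 0) => h; set eI := (X in X = 0) => hI.
set eJ := (X in X = 0) => hJ; set eK := (X in X = 0) => hK.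
apply: row4P; rewrite [RHS]mxE; apply: cancel.
- transitivity (x0 * e - x1 * eI - x2 * eJ - x3 * eK); last by rewrite h hI hJ hK; ring.
  by rewrite /N /e /eI /eJ /eK -/x0 -/x1 -/x2 -/x3; ring.
- transitivity (x1 * e + x0 * eI - x3 * eJ + x2 * eK); last by rewrite h hI hJ hK; ring.
  by rewrite /N /e /eI /eJ /eK -/x0 -/x1 -/x2 -/x3; ring.
- transitivity (x2 * e + x3 * eI + x0 * eJ - x1 * eK); last by rewrite h hI hJ hK; ring.
  by rewrite /N /e /eI /eJ /eK -/x0 -/x1 -/x2 -/x3; ring.
- transitivity (x3 * e - x2 * eI + x1 * eJ + x0 * eK); last by rewrite h hI hJ hK; ring.
  by rewrite /N /e /eI /eJ /eK -/x0 -/x1 -/x2 -/x3; ring.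
Qed.

Lemma open_punctured : open (punctured : set 'rV[R]_4).
Proof.
rewrite (_ : punctured = ~` [set 0]).
  exact/closed_openC/accessible_closed_set1/hausdorff_accessible/norm_hausdorff.
by apply/seteqP; split => x /= /eqP.
Qed.

(** Skewness makes [x *m A] orthogonal to [x], and linearity gives the homogeneity by which the
    field descends to projective space. *)
Lemma vector_field_skew A : A^T = - A -> vector_field (fun x => x *m A).
Proof.
move=> At; split; first exact: smooth_on_mulmx.
- by move=> x _; rewrite tangentE dotC dot_skew.
- by move=> c x; rewrite scalemxAl.
Qed.

(** * Connection coefficients of the frame *)

Section LeviCivita.
Variables (nabla : operator R).
Hypothesis LC : levi_civita g_St nabla.

Lemma lc_skew_torsion A B x : A^T = - A -> B^T = - B -> x != 0 ->
  nabla (fun y => y *m A) (fun y => y *m B) x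
  - nabla (fun y => y *m B) (fun y => y *m A) x = x *m (A *m B - B *m A).
Proof.
move=> At Bt x0; have [_ tf _] := LC.
rewrite tf //; [|exact: vector_field_skew..].
by rewrite /lie_bracket /along !derive_mulmx mulmxBr !mulmxA.
Qed.

(** The hypothesis on [c] says that the two fields have constant [g_St] product, whose derivative
    vanishes in the metric compatibility formula. *)
Lemma lc_skew_metric A B C x (c : R) : A^T = - A -> B^T = - B -> C^T = - C -> x != 0 ->
  (forall y, dot (y *m B) (y *m C) = c * dot y y) ->
  dot (nabla (fun y => y *m A) (fun y => y *m B) x) (x *m C)
  + dot (nabla (fun y => y *m A) (fun y => y *m C) x) (x *m B) = 0.
Proof.
move=> At Bt Ct x0 cE; have [_ _ mc] := LC.
have := mc _ _ _ x (vector_field_skew At) (vector_field_skew Bt) (vector_field_skew Ct) x0.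
rewrite /along /g_St (near_eq_derive (g := cst c)); last first.
  apply: filterS (open_nbhs_nbhs (conj open_punctured x0)) => y y0.
  by rewrite cE mulfK //; exact/lt0r_neq0/dot_gt0.
rewrite derive_cst -mulrDl => /esym/eqP.
rewrite mulf_eq0 invr_eq0 (negPf (lt0r_neq0 (dot_gt0 x0))) orbF => /eqP.
by rewrite (dotC (x *m B)).
Qed.

(** Koszul's computation: the frame is orthonormal for [g_St] and the bracket of the fields of [I]
    and [J] is twice that of [K], so the covariant derivative is half the bracket. Completeness of
    the frame is a hypothesis in order that the lemma apply to every rotation of the standard
    triple. *)
Lemma lc_frame I J K x : quaternionic I J K -> x != 0 ->
  (forall v, dot v x = 0 -> dot v (x *m I) = 0 -> dot v (x *m J) = 0 ->
     dot v (x *m K) = 0 -> v = 0) ->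
  [/\ nabla (fun y => y *m I) (fun y => y *m I) x = 0,
      nabla (fun y => y *m I) (fun y => y *m J) x = x *m K
    & nabla (fun y => y *m J) (fun y => y *m I) x = - (x *m K)].
Proof.
move=> q x0 total; have q' := quaternionic_rot q; have q'' := quaternionic_rot q'.
have [[It Jt] Kt] := (quat_I q, quat_J q, quat_K q).
have dJI y : dot (y *m J) (y *m I) = 0 * dot y y by rewrite mul0r (quat_dot_off y q).
have dKJ y : dot (y *m K) (y *m J) = 0 * dot y y by rewrite mul0r (quat_dot_off y q').
have dIK y : dot (y *m I) (y *m K) = 0 * dot y y by rewrite mul0r (quat_dot_off y q'').
have dII y : dot (y *m I) (y *m I) = 1 * dot y y by rewrite mul1r (quat_dot_diag y q).
have dJJ y : dot (y *m J) (y *m J) = 1 * dot y y by rewrite mul1r (quat_dot_diag y q').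
have dKK y : dot (y *m K) (y *m K) = 1 * dot y y by rewrite mul1r (quat_dot_diag y q'').
have tan A B : A^T = - A -> B^T = - B ->
    dot (nabla (fun y => y *m A) (fun y => y *m B) x) x = 0.
  move=> At Bt; apply/eqP; rewrite -tangentE; have [[lcv _ _ _ _] _ _] := LC.
  have [_ + _] := lcv _ _ (vector_field_skew At) (vector_field_skew Bt).
  exact.
(* The connection coefficients of the frame, scaled by [dot x x]. Torsion-freeness and metric
   compatibility become linear equations in them, which [lra] solves below. *)
pose G A B C := dot (nabla (fun y => y *m A) (fun y => y *m B) x) (x *m C).
have mS A B : A^T = - A -> B^T = - B ->
    (forall y, dot (y *m B) (y *m B) = 1 * dot y y) -> G A B B = 0.
  move=> At Bt BB; have := lc_skew_metric At Bt Bt x0 BB.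
  by move/eqP; rewrite -mulr2n mulrn_eq0 => /eqP.
have mO A B C := fun At Bt Ct => @lc_skew_metric A B C x 0 At Bt Ct x0.
have tor A B C D : A^T = - A -> B^T = - B -> x *m (A *m B - B *m A) = D ->
    G A B C - G B A C = dot D (x *m C).
  by move=> At Bt ABE; rewrite -ABE -lc_skew_torsion // dotBl.
have brIJ : x *m (I *m J - J *m I) = x *m K + x *m K.
  by rewrite (quat_IJ q) (quat_JI q) opprK mulmxDr.
have brJK : x *m (J *m K - K *m J) = x *m I + x *m I.
  by rewrite (quat_JK q) (quat_JI q') opprK mulmxDr.
have brKI : x *m (K *m I - I *m K) = x *m J + x *m J.
  by rewrite (quat_KI q) (quat_JI q'') opprK mulmxDr.
have tI C := tor _ _ C _ It Jt brIJ.
have tJ C := tor _ _ C _ Jt Kt brJK.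
have tK C := tor _ _ C _ Kt It brKI.
have mIJI := mO I J I It Jt It dJI.
have mIKI : G I I K + G I K I = 0 := mO I I K It It Kt dIK.
have GJII := mS J I Jt It dII.
have GKII := mS K I Kt It dII.
have mIKJ := mO I K J It Kt Jt dKJ.
have mJIK := mO J I K Jt It Kt dIK.
have mKJI := mO K J I Kt Jt It dJI.
rewrite -!/(G _ _ _) in mIJI mIKJ mJIK mKJI.
have [h1 h2 h3 h4 h5] := And5 (tI I) (tK I) (tI K) (tJ I) (tK J).
rewrite !dotDl dII dJJ dKK (dotC (x *m K)) dIK dJI !mul0r !mul1r in h1 h2 h3 h4 h5.
have GIII := mS I I It It dII.
have GIJJ := mS I J It Jt dJJ.
have nIJ : nabla (fun y => y *m I) (fun y => y *m J) x = x *m K.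
  apply/eqP; rewrite -subr_eq0; apply/eqP/total; rewrite dotBl.
  - by rewrite tan // (dotC _ x) dot_skew // subrr.
  - by rewrite -/(G I J I) (dotC (x *m K)) dIK; lra.
  - by rewrite -/(G I J J) GIJJ dKJ; lra.
  - by rewrite -/(G I J K) dKK; lra.
split=> //.
  apply: total; first exact: tan.
  - exact: GIII.
  - by rewrite -/(G I I J); lra.
  - by rewrite -/(G I I K); lra.
(* The remaining derivative follows from the torsion: [nabla] of [J] by [I] minus [nabla] of [I] by
   [J] is twice [x *m K]. *)
have := lc_skew_torsion It Jt x0; rewrite brIJ nIJ => /addrI <-.
by rewrite opprK.
Qed.

End LeviCivita.

End Quaternions.

(** * The Gauss and Codazzi equations *)

Section Hessian.
Context {R : realType}.
Variable U : set 'rV[R]_4.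
Hypothesis oU : open U.
Implicit Types (A B C I J K : 'M[R]_4) (f g : 'rV[R]_4 -> R).

(** No connection term is subtracted, because the frame fields are geodesic: the covariant
    derivative of each along itself is zero. *)
Definition hess_diag A f : 'rV[R]_4 -> R := DX A (DX A f).

(* The covariant Hessian of f on the fields of A and B, when nabla_A B = C. *)
Definition hess_off A B C f x : R := DX A (DX B f) x - DX C f x.

Lemma smooth_on_sub f g : smooth_on U f -> smooth_on U g ->
  smooth_on U (fun y => f y - g y).
Proof.
move=> sf sg k.
have -> : (fun y => f y - g y) = (fun y => f y + (-1) * g y).
  by apply/funext => y; rewrite mulN1r.
exact: (Ck_onD oU (sf k) (Ck_onM oU (Ck_on_cst _ _ (-1 : R)) (sg k))).
Qed.

Lemma smooth_on_hess_diag A f : smooth_on U f -> smooth_on U (hess_diag A f).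
Proof. by move=> sf; do 2!apply: smooth_on_DX => //. Qed.

Lemma smooth_on_hess_off A B C f : smooth_on U f -> smooth_on U (hess_off A B C f).
Proof.
move=> sf; apply: smooth_on_sub; first by do 2!apply: smooth_on_DX => //.
exact: smooth_on_DX.
Qed.

Lemma quat_comm I J K g y : quaternionic I J K -> smooth_on U g -> U y ->
  DX I (DX J g) y = DX J (DX I g) y + 2 * DX K g y.
Proof.
move=> q sg Uy; apply/eqP; rewrite addrC -subr_eq; apply/eqP.
rewrite (DX_comm _ _ oU sg Uy) (quat_IJ q) (quat_JI q) opprK DXDmx.
  by rewrite mulr2n mulrDl !mul1r.
exact: smooth_on_differentiable sg Uy.
Qed.

Section Codazzi.
Variables (I J K : 'M[R]_4) (f : 'rV[R]_4 -> R) (x : 'rV[R]_4).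
Hypotheses (q : quaternionic I J K) (sf : smooth_on U f) (Ux : U x).

Let q' := quaternionic_rot q.
Let q'' := quaternionic_rot q'.

Let sX A g : smooth_on U g -> smooth_on U (DX A g).
Proof. exact: smooth_on_DX. Qed.

Let dX g y : smooth_on U g -> U y -> differentiable g y.
Proof. exact: smooth_on_differentiable. Qed.

Let sf1 A := sX A sf.
Let sf2 A B := sX A (sf1 B).

(** This identity and the next two are Ricci identities: antisymmetrizing the derivative of the
    Hessian leaves Hessian terms, which lie in the normal line, and a first-order curvature term,
    absent from the third. *)
Lemma codazzi1 :
  DX I (hess_off I J K f) x - DX J (hess_diag I f) x
  = 3 * hess_off K I J f x + DX J f x.
Proof.
rewrite /hess_off DXB; [|exact/dX..].
(* The commutation takes place under an outer derivative, so it is used as an equality on all of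
   [U]. *)
rewrite (DX_eq _ oU (fun y Uy => quat_comm q sf Uy) Ux) DXD; [|exact/dX|]; last first.
  by apply: differentiableM; [exact: differentiable_cst|exact/dX].
rewrite DXM; [|exact: differentiable_cst|exact/dX].
rewrite DX_cst (quat_comm q (sf1 I) Ux) /hess_diag (quat_comm q'' sf Ux) /=.
ring.
Qed.

Lemma codazzi2 :
  DX I (hess_diag J f) x - DX J (hess_off I J K f) x
  = 3 * hess_off J K I f x - DX I f x.
Proof.
rewrite /hess_off DXB; [|exact/dX..].
rewrite /hess_diag (quat_comm q (sf1 J) Ux) (quat_comm q' sf Ux).
ring.
Qed.

Lemma codazzi3 :
  DX I (hess_off J K I f) x - DX J (hess_off K I J f) x
  = 2 * hess_diag K f x - hess_diag I f x - hess_diag J f x.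
Proof.
rewrite /hess_off DXB; [|exact/dX..].
rewrite DXB; [|exact/dX..].
rewrite (DX_eq J oU (fun y Uy => quat_comm q'' sf Uy) Ux) DXD; [|exact/dX|]; last first.
  by apply: differentiableM; [exact: differentiable_cst|exact/dX].
rewrite DXM; [|exact: differentiable_cst|exact/dX].
rewrite DX_cst (quat_comm q (sf1 K) Ux) /hess_diag /=.
ring.
Qed.

End Codazzi.

(* The numbers n b x * v a - n a x * v b are the coordinates of v modulo the line
   spanned by n, up to the nonzero factor n b x. *)
Lemma proportional_deriv (m : nat) (s n : 'I_m -> 'rV[R]_4 -> R) A x b :
  (forall a, differentiable (s a) x) -> (forall a, differentiable (n a) x) ->
  U x -> (forall y, U y -> forall a c, s a y * n c y = s c y * n a y) ->
  n b x != 0 -> forall a,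
  n b x * DX A (s a) x - n a x * DX A (s b) x
  = s b x / n b x * (n b x * DX A (n a) x - n a x * DX A (n b) x).
Proof.
move=> ds dn Ux prop nb a.
have := DX_eq A oU (fun y Uy => prop y Uy a b) Ux.
rewrite !DXM // => E.
have sE c : s c x = s b x / n b x * n c x.
  by rewrite mulrAC (prop x Ux b c) mulfK.
move: E; rewrite (sE a) => E.
set k := s b x / n b x in E *.
have kb : s b x = k * n b x by rewrite /k divfK.
rewrite kb in E.
transitivity (k * n a x * DX A (n b) x + n b x * DX A (s a) x
  - n a x * DX A (s b) x - k * n a x * DX A (n b) x); last first.
  by rewrite E; move: (n a x) (n b x) => ? ?; ring.
by move: (n a x) (n b x) => ? ?; ring.
Qed.

(** Proportionality is expressed by vanishing minors, a polynomial identity that can be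
    differentiated. *)
Lemma line_proportional (L : {vspace 'rV[R]_4}) (u v : 'rV[R]_4) a c :
  \dim L = 1%N -> u \in L -> v \in L -> u 0 a * v 0 c = u 0 c * v 0 a.
Proof.
move=> dL uL vL; have [->|v0] := eqVneq v 0; first by rewrite !mxE !mulr0.
have LE : <[v]>%VS = L.
  by apply/eqP; rewrite eqEdim -memvE vL dL dim_vline v0.
move: uL; rewrite -LE => /vlineP[k ->]; rewrite !mxE.
by rewrite mulrAC.
Qed.

(** * Umbilicity *)

Section Umbilic.
Variables (f : 'I_4 -> 'rV[R]_4 -> R) (L : 'rV[R]_4 -> {vspace 'rV[R]_4}).
Hypothesis sf : forall a, smooth_on U (f a).
Hypothesis dimL : forall y, U y -> \dim (L y) = 1%N.

Definition in_line (s : 'I_4 -> 'rV[R]_4 -> R) : Prop :=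
  forall y, U y -> \row_a s a y \in L y.

Definition hess_in_line I J K : Prop :=
  [/\ in_line (fun a => hess_diag I (f a)), in_line (fun a => hess_diag J (f a)),
      in_line (fun a => hess_diag K (f a))
    & [/\ in_line (fun a => hess_off I J K (f a)), in_line (fun a => hess_off J K I (f a))
        & in_line (fun a => hess_off K I J (f a))]].

Lemma hess_in_line_rot I J K : hess_in_line I J K -> hess_in_line J K I.
Proof. by case=> ? ? ? [? ? ?]. Qed.

(** Joins two facts: the images of the frame are independent, and their span meets the normal line
    only in zero. *)
Definition frame_transversal I J K : Prop := forall x u v w, U x ->
  u *: \row_a DX I (f a) x + v *: \row_a DX J (f a) x + w *: \row_a DX K (f a) x \in L x ->
  [/\ u = 0, v = 0 & w = 0].

Lemma frame_transversal_rot I J K : frame_transversal I J K -> frame_transversal J K I.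
Proof.
move=> ft x u v w Ux; rewrite addrC addrA => /(ft x _ _ _ Ux)[? ? ?].
by split.
Qed.

Section Direction.
Variables (n : 'I_4 -> 'rV[R]_4 -> R) (x : 'rV[R]_4) (b : 'I_4).
Hypotheses (sn : forall a, smooth_on U (n a)) (nL : in_line n) (Ux : U x) (nb : n b x != 0).

(** Linear in [t], with kernel the line spanned by the value of [n] at [x]: a concrete model of the
    quotient by the normal line. *)
Let wedge (t : 'I_4 -> R) := \row_a (n b x * t a - n a x * t b).

Let coef (s : 'I_4 -> 'rV[R]_4 -> R) := s b x / n b x.

Let prop s : in_line s ->
  forall y, U y -> forall a c, s a y * n c y = s c y * n a y.
Proof.
by move=> sL y Uy a c; have := line_proportional a c (dimL Uy) (sL y Uy) (nL Uy); rewrite !mxE.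
Qed.

(** Where [s = k n], the derivative is [k' n + k n'], and [wedge] kills the first term. *)
Let wedge_deriv s A : (forall a, smooth_on U (s a)) -> in_line s ->
  wedge (fun a => DX A (s a) x) = coef s *: wedge (fun a => DX A (n a) x).
Proof.
move=> ss sL; apply/rowP => a; rewrite !mxE.
apply: proportional_deriv => //; last exact: prop.
- by move=> c; exact: smooth_on_differentiable (ss c) Ux.
- by move=> c; exact: smooth_on_differentiable (sn c) Ux.
Qed.

Let wedge0 s : in_line s -> wedge (fun a => s a x) = 0.
Proof.
move=> sL; apply/rowP => a; rewrite !mxE (mulrC (n b x)) (prop sL Ux a b).
by rewrite mulrC subrr.
Qed.

Let wedgeD s t : wedge (fun a => s a + t a) = wedge s + wedge t.
Proof. by apply/rowP => a; rewrite !mxE; ring. Qed.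
Let wedgeB s t : wedge (fun a => s a - t a) = wedge s - wedge t.
Proof. by apply/rowP => a; rewrite !mxE; ring. Qed.
Let wedgeZ k s : wedge (fun a => k * s a) = k *: wedge s.
Proof. by apply/rowP => a; rewrite !mxE; ring. Qed.

(** In the three Ricci identities the Hessian terms on the right die modulo the normal line; only
    the first-order terms remain. *)
Lemma codazzi_mod I J K : quaternionic I J K -> hess_in_line I J K ->
  [/\ coef (fun a => hess_off I J K (f a)) *: wedge (fun a => DX I (n a) x)
        - coef (fun a => hess_diag I (f a)) *: wedge (fun a => DX J (n a) x)
      = wedge (fun a => DX J (f a) x),
      coef (fun a => hess_diag J (f a)) *: wedge (fun a => DX I (n a) x)
        - coef (fun a => hess_off I J K (f a)) *: wedge (fun a => DX J (n a) x)
      = - wedge (fun a => DX I (f a) x)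
    & coef (fun a => hess_off J K I (f a)) *: wedge (fun a => DX I (n a) x)
        - coef (fun a => hess_off K I J (f a)) *: wedge (fun a => DX J (n a) x)
      = 0].
Proof.
move=> q [pI pJ pK [qIJ qJK qKI]].
have sd A a := smooth_on_hess_diag A (sf a).
have so A B C a := smooth_on_hess_off A B C (sf a).
have [wIJ wJK wKI] := And3 (fun A => wedge_deriv A (so I J K) qIJ)
  (fun A => wedge_deriv A (so J K I) qJK) (fun A => wedge_deriv A (so K I J) qKI).
have [wI wJ] := (fun A => wedge_deriv A (sd I) pI, fun A => wedge_deriv A (sd J) pJ).
split.
- rewrite -wIJ -wI -wedgeB; under eq_fun do rewrite (codazzi1 q (sf _) Ux).
  by rewrite wedgeD wedgeZ (wedge0 qKI) scaler0 add0r.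
- rewrite -wIJ -wJ -wedgeB; under eq_fun do rewrite (codazzi2 q (sf _) Ux).
  by rewrite wedgeB wedgeZ (wedge0 qJK) scaler0 add0r.
- rewrite -wJK -wKI -wedgeB.
  have -> : (fun a => DX I (hess_off J K I (f a)) x - DX J (hess_off K I J (f a)) x) =
      (fun a => 2 * hess_diag K (f a) x - hess_diag I (f a) x - hess_diag J (f a) x).
    by apply/funext => a; exact: (codazzi3 q (sf a) Ux).
  rewrite (wedgeB (fun a => 2 * hess_diag K (f a) x - hess_diag I (f a) x)).
  rewrite (wedgeB (fun a => 2 * hess_diag K (f a) x)) wedgeZ.
  transitivity (2 *: 0 - 0 - 0 : 'rV[R]_4); last by rewrite scaler0 !subr0.
  by congr (2 *: _ - _ - _); [exact: (wedge0 pK)|exact: (wedge0 pI)|exact: (wedge0 pJ)].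
Qed.

(** A combination of frame vectors killed by [wedge] is a multiple of [n], hence lies in the normal
    line, and transversality applies. *)
Lemma wedge_free I J K : frame_transversal I J K -> forall u v : R,
  u *: wedge (fun a => DX J (f a) x) + v *: wedge (fun a => DX I (f a) x) = 0 ->
  u = 0 /\ v = 0.
Proof.
move=> ft u v E; pose w a := u * DX J (f a) x + v * DX I (f a) x.
have wE a : w a = w b / n b x * n a x.
  have /rowP/(_ a) := E; rewrite !mxE => Ea; apply: (mulfI nb).
  apply/eqP; rewrite -subr_eq0 -[X in _ == X]Ea; apply/eqP.
  rewrite mulrCA mulrA divfK // /w; move: (n b x) (n a x) => ? ?.
  by ring.
have [||-> -> _] := ft x v u 0 => //.
rewrite scale0r addr0.
rewrite (_ : _ + _ = (w b / n b x) *: \row_a n a x); first exact/rpredZ/nL.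
by apply/rowP => a; rewrite !mxE -wE addrC.
Qed.

Let coef_eq0 s : in_line s -> coef s = 0 -> forall a, s a x = 0.
Proof.
move=> sL c0 a; apply: (mulIf nb); rewrite (prop sL Ux) mul0r.
by move/eqP: c0; rewrite mulf_eq0 invr_eq0 (negPf nb) orbF => /eqP ->; rewrite mul0r.
Qed.

Let coef_eq s t : in_line s -> in_line t -> coef s = coef t -> forall a, s a x = t a x.
Proof.
move=> sL tL st a; apply: (mulIf nb); rewrite (prop sL Ux) (prop tL Ux).
by congr (_ * _); apply: (mulIf (invr_neq0 nb)).
Qed.

Lemma umbilic_dir I J K : quaternionic I J K -> hess_in_line I J K ->
  frame_transversal I J K -> forall a,
  [/\ hess_off I J K (f a) x = 0, hess_off J K I (f a) x = 0
    & hess_diag I (f a) x = hess_diag J (f a) x].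
Proof.
move=> q h ft.
have q' := quaternionic_rot q; have q'' := quaternionic_rot q'.
have h' := hess_in_line_rot h; have h'' := hess_in_line_rot h'.
have ft' := frame_transversal_rot ft.
have [pI pJ pK [qIJ qJK qKI]] := h.
have [_ c2 _] := codazzi_mod q'' h''.
have [zIJ zJK e] := codazzi_linear (wedge_free ft) (wedge_free ft')
  (codazzi_mod q h) (codazzi_mod q' h') c2.
move=> a; split.
- exact: (coef_eq0 qIJ zIJ).
- exact: (coef_eq0 qJK zJK).
- exact: (coef_eq pI pJ e).
Qed.

End Direction.

(** The Hessian components themselves serve as the smooth normal direction [n]. If one of the four
    in the conclusion is nonzero at [x], it is a valid choice; if all four vanish there, the
    conclusion is immediate. *)
Lemma umbilic I J K x : quaternionic I J K -> hess_in_line I J K ->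
  frame_transversal I J K -> U x -> forall a,
  [/\ hess_off I J K (f a) x = 0, hess_off J K I (f a) x = 0
    & hess_diag I (f a) x = hess_diag J (f a) x].
Proof.
move=> q h ft Ux; have [pI pJ _ [qIJ qJK _]] := h.
have dir n : (forall a, smooth_on U (n a)) -> in_line n ->
    (forall a, [/\ hess_off I J K (f a) x = 0, hess_off J K I (f a) x = 0
      & hess_diag I (f a) x = hess_diag J (f a) x]) \/ (forall a, n a x = 0).
  move=> sn nL; have [[b nb]|n0] := pselect (exists b, n b x != 0).
    by left; apply: (umbilic_dir sn nL Ux nb q h ft).
  by right => a; apply/eqP/negPn/negP => na; apply: n0; exists a.
have [//|zI] := dir _ (fun a => smooth_on_hess_diag I (sf a)) pI.
have [//|zJ] := dir _ (fun a => smooth_on_hess_diag J (sf a)) pJ.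
have [//|zIJ] := dir _ (fun a => smooth_on_hess_off I J K (sf a)) qIJ.
have [//|zJK] := dir _ (fun a => smooth_on_hess_off J K I (sf a)) qJK.
by move=> a; split; [exact: zIJ|exact: zJK|rewrite zI zJ].
Qed.

(** By umbilicity the inner [DX I (DX I (f a))] may be exchanged for the Hessian along [J]; in
    [codazzi2] all off-diagonal terms then vanish, leaving the curvature term. *)
Lemma umbilic_third I J K x : quaternionic I J K -> hess_in_line I J K ->
  frame_transversal I J K -> U x -> forall a,
  DX I (DX I (DX I (f a))) x = - DX I (f a) x.
Proof.
move=> q h ft Ux a.
have Z1 : DX J (hess_off I J K (f a)) x = 0.
  rewrite (DX_eq (g := cst 0) J oU _ Ux) => [|y Uy]; first exact: DX_cst.
  by have [] := umbilic q h ft Uy a.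
have Z2 : DX I (DX I (DX I (f a))) x = DX I (hess_diag J (f a)) x.
  by apply: (DX_eq I oU _ Ux) => y Uy; have [] := umbilic q h ft Uy a.
have := codazzi2 q (sf a) Ux; rewrite Z1 -Z2 subr0 => ->.
by have [_ -> _] := umbilic q h ft Ux a; rewrite mulr0 sub0r.
Qed.

End Umbilic.

End Hessian.

(** * Great circles *)

Lemma derive_even (R : realType) (V W : normedModType R) (f : V -> W) (x v : V) :
  (forall y, f (- y) = f y) -> 'D_(- v) f (- x) = 'D_v f x.
Proof.
move=> ev; rewrite /derive ev.
have -> : f \o shift (- x) = (f \o shift x) \o -%R.
  by apply/funext => y /=; rewrite -ev opprD opprK.
by rewrite /=; under eq_fun do rewrite scalerN opprK.
Qed.

Section GreatCircle.
Context {R : realType}.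
Variables (J : 'M[R]_4) (f : 'rV[R]_4 -> R).
Hypotheses (JJ : J *m J = - 1%:M) (sf : smooth_on punctured f).

(** The orbit of [x] under the one-parameter group generated by [J], that is, the integral curve of
    the field of [J]; it reaches [- x] at time [pi]. *)
Let circle (x : 'rV[R]_4) (t : R) : 'rV[R]_4 := cos t *: x + sin t *: (x *m J).

Lemma is_derive_circle x t : is_derive t (1 : R) (circle x) (circle x t *m J).
Proof.
have -> : circle x t *m J = (- sin t) *: x + cos t *: (x *m J).
  by rewrite mulmxDl -!scalemxAl -mulmxA JJ mulmxN mulmx1 scalerN scaleNr addrC.
have hc := is_derive_scalel x (is_derive_cos t).
have hs := is_derive_scalel (x *m J) (is_derive_sin t).
exact: is_deriveD hc hs.
Qed.

Lemma circle_neq0 x t : x != 0 -> circle x t != 0.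
Proof.
apply: contra => /eqP c0.
(* Rotating back by the angle [t] recovers [x]. *)
have <- : cos t *: circle x t - sin t *: (circle x t *m J) = x.
  rewrite mulmxDl -!scalemxAl -mulmxA JJ mulmxN mulmx1 /circle.
  apply/rowP => j; move: (x *m J) => y; rewrite !mxE.
  transitivity ((cos t ^+ 2 + sin t ^+ 2) * x 0 j); first by ring.
  by rewrite cos2Dsin2 mul1r.
by rewrite c0 mul0mx !scaler0 subrr.
Qed.

Lemma is_derive_along_circle (g : 'rV[R]_4 -> R) x t : x != 0 ->
  smooth_on punctured g ->
  is_derive t (1 : R) (g \o circle x) (DX J g (circle x t)).
Proof.
move=> x0 sg; rewrite DX_def; apply: is_derive_curve (is_derive_circle x t) _.
by apply: smooth_on_differentiable sg _; exact: circle_neq0.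
Qed.

(* Along a great circle u = DX J f satisfies u'' = - u, hence u changes sign
   under t -> t + pi, i.e. at antipodal points. *)
Lemma DX_even_eq0 x : x != 0 -> (forall y, f (- y) = f y) ->
  (forall y, y != 0 -> DX J (DX J (DX J f)) y = - DX J f y) -> DX J f x = 0.
Proof.
move=> x0 ev ode.
have s1 := smooth_on_DX J open_punctured sf.
have s2 := smooth_on_DX J open_punctured s1.
pose u := DX J f \o circle x; pose w := DX J (DX J f) \o circle x.
(* With [u' = w] and [w' = - u] this is a first integral. Its values at [0] and [pi] are [u 0] and
   [- u pi], while evenness of [f] gives [u pi = u 0]. *)
have cst0 (t : R) : is_derive t (1 : R) (u * (cos : R -> R) - w * (sin : R -> R)) 0.
  have du : is_derive t (1 : R) u (w t) := is_derive_along_circle t x0 s1.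
  have dw : is_derive t (1 : R) w (- u t).
    by rewrite /u /= -ode ?circle_neq0 //; exact: is_derive_along_circle t x0 s2.
  apply: (is_derive_eq (is_deriveB (is_deriveM du (is_derive_cos t))
    (is_deriveM dw (is_derive_sin t)))).
  rewrite -![_ *: _]/(_ * _); ring.
have := is_derive_0_is_cst 0 pi cst0.
rewrite !fctE /u /w /= /circle cos0 sin0 cospi sinpi scale1r !scale0r !addr0.
rewrite scaleN1r [DX J f (- x)]DX_def mulNmx derive_even // -DX_def.
lra.
Qed.

End GreatCircle.

(** * Immersions of the projective space *)

Section Immersion.
Context {R : realType}.

Lemma line_opp (x : 'rV[R]_4) : line (- x) = line x.
Proof.
rewrite /line (_ : <[- x]>%VS = <[x]>%VS) //; apply/eqP.
by rewrite eqEsubv -!memvE memvN memv_line -memvN memv_line.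
Qed.

Variables (nabla : operator R) (i : RP3 R -> 'rV[R]_4) (l : RP3 R -> RP3 R).
Hypotheses (LC : levi_civita g_St nabla) (imm : immersion i)
  (tr : Defs.transversal i l) (ind : induced_connection i l nabla).

Let f (a : 'I_4) (y : 'rV[R]_4) : R := i (line y) 0 a.
Let L (y : 'rV[R]_4) : {vspace 'rV[R]_4} := val (l (line y)).

Lemma smooth_on_coord a : smooth_on punctured (f a).
Proof.
by move=> k; apply: (@Ck_on_coord _ _ k punctured _ (i \o line));
  [exact: open_punctured|exact: imm.1].
Qed.

Lemma differentiable_immersion y : y != 0 -> differentiable (i \o line) y.
Proof. by move=> y0; have [+ _] := imm.1 1%N; apply. Qed.

Lemma TiE y B : y != 0 -> Ti i y (y *m B) = \row_a DX B (f a) y.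
Proof.
move=> y0; have di := differentiable_immersion y0.
rewrite lfunE /=; apply/rowP => a; rewrite mxE DX_def.
have dd : derivable (i \o line) y (y *m B) by exact: diff_derivable.
by rewrite -deriveE // -(derive_coord a dd).
Qed.

Lemma dim_normal_line y : \dim (L y) = 1%N.
Proof. by apply/eqP; exact: valP (l (line y)). Qed.

(** The tangential part of the second derivative of the immersion is the image of the covariant
    derivative, which is the field of [C]; subtracting it leaves the projection onto the normal
    line. *)
Lemma hess_in_normal A B C : A^T = - A -> B^T = - B ->
  (forall y, y != 0 -> nabla (fun z => z *m A) (fun z => z *m B) y = y *m C) ->
  in_line punctured L (fun a => hess_off A B C (f a)).
Proof.
move=> At Bt nE y y0.
have := ind (vector_field_skew At) (vector_field_skew Bt) y0.
rewrite (nE y y0) => /(etrans (esym (TiE C y0))); rewrite /along.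
set w := 'D_(y *m A) _ y => E.
have rowE a : (fun z => (\row_a DX B (f a) z) 0 a) = DX B (f a).
  by apply/funext => z; rewrite mxE.
have wE : w = \row_a DX A (DX B (f a)) y.
  rewrite /w (near_eq_derive (g := fun z => \row_a DX B (f a) z)); last first.
    by apply: filterS (open_nbhs_nbhs (conj open_punctured y0)) => z z0; exact: TiE.
  rewrite derive_mx.
    by apply/rowP => a; rewrite !mxE DX_def rowE.
  apply/derivable_mxP => j a; rewrite ord1 rowE.
  apply/diff_derivable/(smooth_on_differentiable _ y0)/smooth_on_DX/smooth_on_coord.
  exact: open_punctured.
have [full triv] := tr.2 y y0.
have -> : \row_a hess_off A B C (f a) y = w - \row_a DX C (f a) y.
  by rewrite wE; apply/rowP => a; rewrite !mxE.
rewrite E -[X in X - _](daddv_pi_add triv) ?full ?memvf //.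
by rewrite addrAC subrr add0r memv_pi.
Qed.

(** Transversality gives [Ti i y z = 0], the immersion property gives [z = 0], and orthogonality of
    the frame makes the three coefficients vanish. *)
Lemma frame_transversal_quat I J K : quaternionic I J K ->
  frame_transversal punctured f L I J K.
Proof.
move=> q y u v w y0; have q' := quaternionic_rot q; have q'' := quaternionic_rot q'.
rewrite -!TiE // -!linearZ -!linearD /=; set z := (X in Ti i y X) => zL.
have zE : z = u *: (y *m I) + v *: (y *m J) + w *: (y *m K).
  by rewrite /z !mulmxDr -!scalemxAr.
have zt : z \in tangent y.
  rewrite tangentE dotC dot_skew // !linearD !linearZ /=.
  by rewrite (quat_I q) (quat_J q) (quat_K q) !scalerN -!opprD.
have z0 : z = 0.
  have [_ triv] := tr.2 y y0.
  have Tz : Ti i y z = 0.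
    by apply/eqP; rewrite -memv0 -triv memv_cap zL andbT; exact: memv_img.
  apply/eqP; rewrite -memv0 -(imm.2 y y0) memv_cap zt andbT.
  by rewrite memv_ker Tz.
have dz A : dot z (y *m A) = u * dot (y *m I) (y *m A) + v * dot (y *m J) (y *m A)
    + w * dot (y *m K) (y *m A).
  by rewrite zE !dotDl !dotZl.
have y2 := lt0r_neq0 (dot_gt0 y0).
have dIJ : dot (y *m I) (y *m J) = 0 by rewrite dotC (quat_dot_off y q).
have dJK : dot (y *m J) (y *m K) = 0 by rewrite dotC (quat_dot_off y q').
have dKI : dot (y *m K) (y *m I) = 0 by rewrite dotC (quat_dot_off y q'').
split; apply: (mulIf y2); rewrite mul0r.
- have := dz I; rewrite z0 dot0l (quat_dot_diag y q) (dotC (y *m J)) dIJ dKI; lra.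
- have := dz J; rewrite z0 dot0l (quat_dot_diag y q') dIJ (dotC (y *m K)) dJK; lra.
- have := dz K; rewrite z0 dot0l (quat_dot_diag y q'') (dotC (y *m I)) dKI dJK; lra.
Qed.

Lemma hess_diag_in_normal A : A^T = - A ->
  (forall y, y != 0 -> nabla (fun z => z *m A) (fun z => z *m A) y = 0) ->
  in_line punctured L (fun a => hess_diag A (f a)).
Proof.
move=> At nE y y0.
have := @hess_in_normal A A 0 At At _ y y0.
have -> : \row_a hess_off A A 0 (f a) y = \row_a hess_diag A (f a) y.
  by apply/rowP => a; rewrite !mxE /hess_off (DX_def 0) mulmx0 derive0 subr0.
by apply => z z0; rewrite mulmx0 nE.
Qed.

Lemma no_equiaffine_immersion : False.
Proof.
have q := @quaternionic_std R; have q' := quaternionic_rot q; have q'' := quaternionic_rot q'.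
set I := quatI in q q' q''; set J := quatJ in q q' q''; set K := quatK in q q' q''.
have t y (y0 : y != 0) := fun v => @quaternionic_total R y v y0.
have F1 y y0 := lc_frame LC q y0 (t y y0).
(* The rotated triples receive the same completeness statement with its premises permuted. *)
have F2 y y0 := lc_frame LC q' y0 (fun v h hJ hK hI => t y y0 v h hI hJ hK).
have F3 y y0 := lc_frame LC q'' y0 (fun v h hK hI hJ => t y y0 v h hI hJ hK).
have [[It Jt] Kt] := (quat_I q, quat_J q, quat_K q).
have h : hess_in_line punctured f L I J K.
  split; [| | |split].
  - by apply: hess_diag_in_normal => // y y0; have [] := F1 y y0.
  - by apply: hess_diag_in_normal => // y y0; have [] := F2 y y0.
  - by apply: hess_diag_in_normal => // y y0; have [] := F3 y y0.
  - by apply: hess_in_normal => // y y0; have [] := F1 y y0.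
  - by apply: hess_in_normal => // y y0; have [] := F2 y y0.
  - by apply: hess_in_normal => // y y0; have [] := F3 y y0.
have ft := frame_transversal_quat q.
pose e : 'rV[R]_4 := delta_mx 0 0.
have e0 : e != 0.
  by apply/eqP => /matrixP/(_ 0 0)/eqP; rewrite !mxE !eqxx oner_eq0.
have DX0 a : DX I (f a) e = 0.
  apply: (DX_even_eq0 (quat_II q) (smooth_on_coord a) e0).
    by move=> y; rewrite /f line_opp.
  move=> y y0; exact: (umbilic_third open_punctured smooth_on_coord
    (fun y _ => dim_normal_line y) q h ft y0).
(* The image of the first frame vector at [e] is zero, so the coefficients [1], [0], [0] contradict
   transversality. *)
have [one _ _] : [/\ (1 : R) = 0, (0 : R) = 0 & (0 : R) = 0].
  apply: (ft e 1 0 0 e0); rewrite !scale0r !addr0 scale1r.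
  by rewrite (_ : \row_a _ = 0) ?mem0v //; apply/rowP => a; rewrite !mxE DX0.
by move/eqP: one; rewrite oner_eq0.
Qed.

End Immersion.

Theorem propositionB1 (R : realType) (E : equiaffine_structure R)
    (Phi : RP3 R -> 'M[R]_3) :
  levi_civita g_St (ea_nabla E) ->
  isometry_RP3_SO3 Phi ->
  corresponds_to_SO3_volume Phi (ea_nu E) ->
  ~ exists (i : RP3 R -> 'rV[R]_4) (l : RP3 R -> RP3 R),
      equiaffine_immersion E i l.
Proof.
move=> LC _ _ [i [l [imm tr ind]]].
exact: no_equiaffine_immersion LC imm tr ind.
Qed.
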